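(* If a complex matrix $M$ is antidiagonalizable, then $M^2$ is diagonalizable.
   Context: A matrix of size $n$ is antidiagonal if its only nonzero entries are at positions $(i,n+1-i)$, and antidiagonalizable if it is similar to an antidiagonal matrix. *)

(* Defs.v *)
From mathcomp Require Import all_boot all_order all_algebra.

Set Implicit Arguments.
Unset Strict Implicit.
Unset Printing Implicit Defensive.

Import GRing.Theory.
Local Open Scope ring_scope.

(* With 1-based indices the antidiagonal is {(i, n + 1 - i)}; on 'I_n, whose
   indices start at 0, it is {(i, n - 1 - i)}, and rev_ord i = n - 1 - i. *)
Definition is_antidiag_mx (V : nmodType) (n : nat) (A : 'M[V]_n) : bool :=
  [forall i : 'I_n, forall j : 'I_n, (j != rev_ord i) ==> (A i j == 0)].

Definition antidiagonalizable (F : fieldType) (n : nat) (A : 'M[F]_n) : Prop :=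
  similar_in_to unitmx A (@is_antidiag_mx F n).

(* Main.v *)
Require Import Defs.
From mathcomp Require Import all_boot all_order all_algebra complex reals.
Import GRing.Theory.
Local Open Scope ring_scope.
Local Open Scope complex_scope.

(** An antidiagonal matrix permutes the coordinate lines by the involution [rev_ord], up to scalars,
    so its square keeps each line: it is diagonal. Conjugation is multiplicative, so the matrix that
    antidiagonalizes [M] diagonalizes its square, over any field. *)

Lemma antidiag_mx_sqr (R : pzRingType) (n : nat) (A : 'M[R]_n) :
  is_antidiag_mx A -> is_diag_mx (A *m A).
Proof.
move=> /forallP antiA.
have A0 i j : j != rev_ord i -> A i j = 0.
  by move=> ji; have /forallP/(_ j)/implyP/(_ ji)/eqP := antiA i.
apply/is_diag_mxP => i j ij; rewrite mxE big1 // => k _.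
have [->|ki] := eqVneq k (rev_ord i); last by rewrite (A0 i k ki) mul0r.
by rewrite (A0 _ j) ?mulr0 // rev_ordK eq_sym.
Qed.

Lemma antidiagonalizable_sqr (F : fieldType) (n : nat) (M : 'M[F]_n) :
  antidiagonalizable M -> diagonalizable (M *m M).
Proof.
case=> P Pu antiM; exists P => //.
(* The row space of the invertible [P] is everything, hence stable, as multiplicativity of [conjmx]
   requires. *)
rewrite /similar_to conjmxM ?inE ?stablemx_unit //.
exact: antidiag_mx_sqr antiM.
Qed.

Theorem corollary5p10 (R : realType) (n : nat) (M : 'M[R[i]]_n) :
  antidiagonalizable M -> diagonalizable (M ^+ 2).
Proof.
by rewrite expr2 -mulmxE; exact: antidiagonalizable_sqr.
Qed.
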